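(* Let $K\in\mathbb{R}^{m\times n}$ be such that $KK^*\in\mathbb{R}^{m\times m}$ is diagonally dominant, let $J(u)=\|Ku\|_1$ on $\mathbb{R}^n$, and let $f\in\mathbb{R}^n$. Then (up to normalization) the subgradients $p_{GF}(t_{i+1})$ of the gradient flow are eigenvectors of $J$, i.e. $$p_{GF}(t_{i+1})\in\partial J\big(p_{GF}(t_{i+1})\big).$$ Hence, $$f=P_0(f)+\sum_{i=0}^{N-1}(t_{i+1}-t_i)\,p_{GF}(t_{i+1}),$$ with $N$ the index for which $u_{GF}(t_N)=P_0(f)$, is a decomposition of $f$ into eigenvectors of $J$.
   Context: $\partial J$ is the convex subdifferential, $K^*$ the transpose of $K$. A matrix $A$ is diagonally dominant if $|A_{ll}|\ge\sum_{j\ne l}|A_{lj}|$ for every $l$. $P_0$ is the orthogonal projection onto the linear subspace $\mathcal{N}(J)=\{u:J(u)=0\}$. A vector $u$ with $\|u\|_2=1$ is an eigenvector (eigenfunction) of $J$ if $\lambda u\in\partial J(u)$ for some $\lambda\in\mathbb{R}$. Gradient flow: $\partial_tu_{GF}(t)=-p_{GF}(t)$, $p_{GF}(t)\in\partial J(u_{GF}(t))$ for a.e. $t>0$, $u_{GF}(0)=f$. Its solution is piecewise affine with finitely many breakpoints $0=t_0<t_1<\dots$, that is $u_{GF}(t)=u_{GF}(t_i)-(t-t_i)\,p_{GF}(t_{i+1})$ for $t\in[t_i,t_{i+1}]$, where $p_{GF}(t_{i+1})$ denotes the constant value of $p_{GF}$ on $(t_i,t_{i+1})$; the last breakpoint $t_N$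 is the extinction time, at which $u_{GF}(t_N)=P_0(f)$. *)

(* Defs.v *)
From mathcomp Require Import all_boot all_order all_algebra.
From mathcomp Require Import all_classical all_reals all_analysis.

Set Implicit Arguments.
Unset Strict Implicit.
Unset Printing Implicit Defensive.

Import Order.TTheory GRing.Theory Num.Theory.
Import numFieldNormedType.Exports.

Local Open Scope classical_set_scope.
Local Open Scope ring_scope.

Section Defs.
Context {R : realType}.

Definition dotp n (u v : 'cV[R]_n) : R := \sum_i u i 0 * v i 0.

(* The library norm `|u| on matrices is the max norm. *)
Definition l2norm n (u : 'cV[R]_n) : R := Num.sqrt (dotp u u).

Definition l1norm n (u : 'cV[R]_n) : R := \sum_i `|u i 0|.

Definition diag_dominant n (A : 'M[R]_n) : Prop :=
  forall l, \sum_(j | j != l) `|A l j| <= `|A l l|.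

Definition l1_functional m n (K : 'M[R]_(m, n)) (u : 'cV[R]_n) : R :=
  l1norm (K *m u).

Definition subdiff n (J : 'cV[R]_n -> R) (u : 'cV[R]_n) : set 'cV[R]_n :=
  [set p | forall v, J u + dotp p (v - u) <= J v].

Definition eigenvector n (J : 'cV[R]_n -> R) (u : 'cV[R]_n) : Prop :=
  l2norm u = 1 /\ exists lambda : R, subdiff J u (lambda *: u).

Definition eigenvector_upto_norm n (J : 'cV[R]_n -> R) (u : 'cV[R]_n) : Prop :=
  u != 0 /\ eigenvector J ((l2norm u)^-1 *: u).

(* The default value 0 of xget is irrelevant: a point g as below is always
   unique when S is a linear subspace, and it exists (see orth_proj_null_l1). *)
Definition orth_proj n (S : set 'cV[R]_n) (f : 'cV[R]_n) : 'cV[R]_n :=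
  xget 0 [set g | S g /\ forall v, S v -> dotp (f - g) v = 0].

Definition null_set n (J : 'cV[R]_n -> R) : set 'cV[R]_n := [set u | J u = 0].

Definition P0 n (J : 'cV[R]_n -> R) (f : 'cV[R]_n) : 'cV[R]_n :=
  orth_proj (null_set J) f.

(* Absolute continuity on every [0, T]; the intervals [a i, b i], i < k,
   are listed from left to right and do not overlap. *)
Definition locally_abs_cont n (u : R -> 'cV[R]_n) : Prop :=
  forall T e : R, 0 < T -> 0 < e -> exists2 d : R, 0 < d &
    forall (k : nat) (a b : nat -> R),
      (forall i, (i < k)%N -> 0 <= a i /\ a i <= b i /\ b i <= T) ->
      (forall i, (i.+1 < k)%N -> b i <= a i.+1) ->
      \sum_(i < k) (b i - a i) < d ->
      \sum_(i < k) l2norm (u (b i) - u (a i)) < e.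

(* Only the values of u and p at nonnegative times are constrained. *)
Record gradient_flow n (J : 'cV[R]_n -> R) (f : 'cV[R]_n)
    (u p : R -> 'cV[R]_n) : Prop := {
  gf_init : u 0 = f;
  gf_abs_cont : locally_abs_cont u;
  gf_flow : {ae @lebesgue_measure R, forall t : R, 0 < t ->
               is_derive t 1 u (- p t) /\ subdiff J (u t) (p t)} }.

(* q i.+1 is the constant value of p on the interval ]t i, t i.+1[; as p is
   determined by the flow only up to a null set, so is its constancy. *)
Record flow_breakpoints n (u p : R -> 'cV[R]_n) (N : nat) (t : nat -> R)
    (q : nat -> 'cV[R]_n) : Prop := {
  bp_start : t 0%N = 0;
  bp_increasing : forall i, (i < N)%N -> t i < t i.+1;
  bp_constant : forall i, (i < N)%N ->
    {ae @lebesgue_measure R, forall s : R, t i < s < t i.+1 -> p s = q i.+1};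
  bp_affine : forall i, (i < N)%N -> forall s : R, t i <= s <= t i.+1 ->
    u s = u (t i) - (s - t i) *: q i.+1 }.

Definition extinction_time n (J : 'cV[R]_n -> R) (f : 'cV[R]_n)
    (u : R -> 'cV[R]_n) (T : R) : Prop :=
  u T = P0 J f /\ forall s : R, 0 <= s < T -> u s <> P0 J f.

Lemma dotpE n (u v : 'cV[R]_n) : dotp u v = (u^T *m v) 0 0.
Proof. by rewrite mxE; apply: eq_bigr => i _; rewrite mxE. Qed.

Lemma dotp_eq0 n (u : 'cV[R]_n) : dotp u u = 0 -> u = 0.
Proof.
move=> /eqP; rewrite /dotp psumr_eq0; last by move=> i _; rewrite -expr2 sqr_ge0.
move=> /allP u0; apply/colP => i; rewrite mxE.
by have := u0 i (mem_index_enum i); rewrite /= mulf_eq0 orbb => /eqP.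
Qed.

Lemma null_set_l1 m n (K : 'M[R]_(m, n)) u :
  null_set (l1_functional K) u <-> K *m u = 0.
Proof.
rewrite /null_set /l1_functional /l1norm /=; split=> [/eqP|->]; last first.
  by apply: big1 => i _; rewrite mxE normr0.
rewrite psumr_eq0 // => /allP Ku0; apply/colP => i; rewrite [RHS]mxE.
by have := Ku0 i (mem_index_enum i); rewrite /= normr_eq0 => /eqP.
Qed.

Lemma orth_proj_null_l1 m n (K : 'M[R]_(m, n)) (f : 'cV[R]_n) :
  let J := l1_functional K in
  null_set J (P0 J f) /\ forall v, null_set J v -> dotp (f - P0 J f) v = 0.
Proof.
move=> J.
have [w wE] : exists w : 'rV_m, f^T *m K^T = w *m (K *m K^T).
  apply/submxP; rewrite submxE -mulmxA; set C := cokermx _.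
  have KC : K *m (K^T *m C) = 0 by rewrite mulmxA mulmx_coker.
  suff -> : K^T *m C = 0 by rewrite mulmx0.
  apply/matrixP => i j; rewrite [RHS]mxE.
  have /dotp_eq0 /colP /(_ i) : dotp (col j (K^T *m C)) (col j (K^T *m C)) = 0.
    have -> : dotp (col j (K^T *m C)) (col j (K^T *m C))
              = ((K^T *m C)^T *m (K^T *m C)) j j.
      by rewrite [RHS]mxE; apply: eq_bigr => k _; rewrite !mxE.
    by rewrite trmx_mul trmxK -mulmxA KC mulmx0 mxE.
  by rewrite !mxE.
have ex : exists g, null_set J g /\ forall v, null_set J v -> dotp (f - g) v = 0.
  exists (f - K^T *m w^T); split.
    apply/null_set_l1; apply: trmx_inj.
    by rewrite mulmxBr linearB /= !trmx_mul !trmxK trmx0 wE mulmxA subrr.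
  move=> v /null_set_l1 Kv; rewrite opprB addrC subrK dotpE.
  by rewrite trmx_mul !trmxK -mulmxA Kv mulmx0 mxE.
exact: (xgetPex 0 ex).
Qed.

End Defs.

(* Main.v *)
Require Import Defs.
From mathcomp Require Import all_boot all_order all_algebra.
From mathcomp Require Import all_classical all_reals all_analysis.
From mathcomp Require Import ring lra.

(** Write z in sign(w) when |z_l| <= 1 and z_l w_l = |w_l| for every l. If z
lies in sign(K u), then K^T z is a subgradient of J = |K .|_1 at u.

On an affine piece of the flow the derivative is - q, where q is a subgradient
of J at two points u and u - h q with h > 0. Comparing with any subgradient p at
u through the decrease of J between them gives <q, q> <= <q, p>, so q is the
element of least norm in the subdifferential at u (subdiff_min_norm_flow).

Such a q has the form K^T z with z in sign(K u)
(min_subgradient_sign_selection). Indeed, let z minimise |K^T z| over the compact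
convex set sign(K u). Since J is affine on a short segment from u in the
direction - K^T z, with slope given by another element of sign(K u), the
subgradient inequality for q and the optimality of z yield
|K^T z|^2 <= <q, K^T z>; together with |q|^2 <= <q, K^T z> this forces
q = K^T z.

Diagonal dominance enters in diag_dominant_sign_selection, which shows that z
also lies in sign(K q), where K q = (K K^T) z. If |z_l| = 1, the diagonal term
dominates the row l of K K^T, so z_l (K q)_l is nonnegative. If |z_l| < 1, then
(K u)_l = 0 and z_l may be moved both ways inside sign(K u), so optimality gives
(K q)_l = 0. Hence q = K^T z is a subgradient of J at q.

The subgradient q is nonzero: otherwise u(s) would be a minimiser of J, that is,
an element of the null space of K, at a time s before extinction; all the
subgradients along the flow being orthogonal to that null space, u(s) would be
the projection of f. Summing the affine pieces gives the decomposition. *)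

Set Implicit Arguments.
Unset Strict Implicit.
Unset Printing Implicit Defensive.

Import Order.TTheory GRing.Theory Num.Theory.
Import numFieldNormedType.Exports.

Local Open Scope classical_set_scope.
Local Open Scope ring_scope.

(** * The Euclidean inner product *)

Lemma dotpC (R : realType) n (u v : 'cV[R]_n) : dotp u v = dotp v u.
Proof. by apply: eq_bigr => i _; rewrite mulrC. Qed.

Lemma dotpDr (R : realType) n (u v w : 'cV[R]_n) :
  dotp u (v + w) = dotp u v + dotp u w.
Proof. by rewrite -big_split; apply: eq_bigr => i _; rewrite mxE mulrDr. Qed.

Lemma dotpZr (R : realType) n (a : R) (u v : 'cV[R]_n) :
  dotp u (a *: v) = a * dotp u v.
Proof. by rewrite mulr_sumr; apply: eq_bigr => i _; rewrite mxE mulrCA. Qed.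

Lemma dotpBr (R : realType) n (u v w : 'cV[R]_n) :
  dotp u (v - w) = dotp u v - dotp u w.
Proof. by rewrite dotpDr -scaleN1r dotpZr mulN1r. Qed.

Lemma dotp_trmx_mul (R : realType) m n (K : 'M[R]_(m, n)) z v :
  dotp (K^T *m z) v = dotp z (K *m v).
Proof. by rewrite !dotpE trmx_mul trmxK mulmxA. Qed.

Lemma dotp_ge0 (R : realType) n (u : 'cV[R]_n) : 0 <= dotp u u.
Proof. by apply: sumr_ge0 => i _; rewrite -expr2 sqr_ge0. Qed.

Lemma dotp_gt0 (R : realType) n (u : 'cV[R]_n) : u != 0 -> 0 < dotp u u.
Proof.
move=> u0; rewrite lt_neqAle dotp_ge0 andbT eq_sym.
by apply: contra_neq u0; exact: dotp_eq0.
Qed.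

Lemma dotp_sqrDZ (R : realType) n (a : R) (u v : 'cV[R]_n) :
  dotp (u + a *: v) (u + a *: v) =
  dotp u u + a * (2 * dotp u v) + a ^+ 2 * dotp v v.
Proof.
rewrite dotpDr dotpZr ![dotp (u + _) _]dotpC !dotpDr !dotpZr (dotpC v u).
by ring.
Qed.

(** Adding the two hypotheses gives |p - q|^2 <= 0. *)
Lemma dotp_sqr_le_eq (R : realType) n (p q : 'cV[R]_n) :
  dotp p p <= dotp q p -> dotp q q <= dotp q p -> p = q.
Proof.
move=> pq qq; apply/eqP; rewrite -subr_eq0; apply/eqP/dotp_eq0/eqP.
rewrite eq_le dotp_ge0 andbT dotpBr ![dotp (p - q) _]dotpC !dotpBr (dotpC p q).
by lra.
Qed.

(** * Subgradients given by sign vectors *)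

(** This is the subdifferential of the l1 norm at w: z_l is the sign of w_l
where w_l is nonzero and is free in [-1, 1] elsewhere. Stating it by the
equation z_l w_l = |w_l| makes closedness and convexity in z apparent. *)
Definition sign_selection {R : realType} n (w z : 'cV[R]_n) : Prop :=
  forall l, `|z l 0| <= 1 /\ z l 0 * w l 0 = `|w l 0|.

Lemma sign_selection_l1 (R : realType) n (w z : 'cV[R]_n) :
  sign_selection w z -> dotp z w = l1norm w.
Proof. by move=> zw; apply: eq_bigr => l _; case: (zw l). Qed.

Lemma dotp_le_l1 (R : realType) n (z w : 'cV[R]_n) :
  (forall l, `|z l 0| <= 1) -> dotp z w <= l1norm w.
Proof.
move=> z1; apply: ler_sum => l _; apply: le_trans (ler_norm _) _.
by rewrite normrM ler_piMl.
Qed.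

(** <K^T z, v> = <z, K v> is at most |K v|_1 for every v, and equals |K u|_1 at
v = u. *)
Lemma subdiff_sign_selection (R : realType) m n (K : 'M[R]_(m, n)) u z :
  sign_selection (K *m u) z -> subdiff (l1_functional K) u (K^T *m z).
Proof.
move=> zu v; rewrite dotpBr !dotp_trmx_mul (sign_selection_l1 zu).
by rewrite addrC subrK; apply: dotp_le_l1 => l; case: (zu l).
Qed.

Lemma l1normZ (R : realType) n (c : R) (w : 'cV[R]_n) :
  l1norm (c *: w) = `|c| * l1norm w.
Proof. by rewrite mulr_sumr; apply: eq_bigr => l _; rewrite mxE normrM. Qed.

Lemma subdiff_Z (R : realType) m n (K : 'M[R]_(m, n)) (c : R) u p : 0 < c ->
  subdiff (l1_functional K) u p -> subdiff (l1_functional K) (c *: u) p.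
Proof.
move=> c0 pu v; have := pu (c^-1 *: v).
rewrite /l1_functional -!scalemxAr !l1normZ !gtr0_norm ?invr_gt0//.
rewrite !dotpBr !dotpZr -(ler_pM2l c0) mulrDr mulrBr !mulrA divff ?gt_eqF//.
by rewrite !mul1r.
Qed.

Lemma sign_selection_segment (R : realType) n (w y z : 'cV[R]_n) (a : R) :
  0 <= a <= 1 -> sign_selection w z -> sign_selection w y ->
  sign_selection w (z + a *: (y - z)).
Proof.
move=> /andP[a0 a1] zw yw l; rewrite !mxE.
have [z1 zl] := zw l; have [y1 yl] := yw l; split; last first.
  by transitivity ((1 - a) * (z l 0 * w l 0) + a * (y l 0 * w l 0));
    [ring | rewrite zl yl; ring].
move: z1 y1; rewrite !ler_norml => /andP[z1 z2] /andP[y1 y2].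
by apply/andP; split; nra.
Qed.

(** The l1 norm is affine on a short segment from w in the direction - d: a
single sign vector serves both ends. *)
Lemma l1_small_step (R : realType) n (w d : 'cV[R]_n) :
  exists z e, [/\ sign_selection w z, 0 < e & sign_selection (w - e *: d) z].
Proof.
(* With this e no nonzero entry of w changes sign; the denominator is
   1 + |d_l| because d_l may vanish. *)
pose e := \big[Num.min/1]_(l | w l 0 != 0) (`|w l 0| / (1 + `|d l 0|)).
have e0 : 0 < e.
  by apply: lt_bigmin => // l wl; rewrite divr_gt0 ?normr_gt0.
(* Where w_l = 0, the sign is that of the displacement - e d_l. *)
exists (\col_l if w l 0 == 0 then - Num.sg (d l 0) else Num.sg (w l 0)), e.
have sg1 (x : R) : `|Num.sg x| <= 1 by rewrite normr_sg; case: eqP.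
split=> // l; rewrite !mxE; (split; first by case: ifP; rewrite ?normrN).
  by case: eqP => [->|_]; rewrite ?mulr0 ?normr0// -normrEsg.
have [->|wl] := eqVneq (w l 0) 0.
  by rewrite add0r mulrNN mulrCA -normrEsg normrN normrM gtr0_norm.
have : e * `|d l 0| <= `|w l 0|.
  have : e <= `|w l 0| / (1 + `|d l 0|) by exact: bigmin_le_cond.
  by rewrite ler_pdivlMr ?ltr_wpDr//; apply: le_trans; rewrite ler_pM2l// lerDr.
rewrite -(gtr0_norm e0) -normrM ler_norml gtr0_norm// => /andP[].
have [w0|w0|/eqP] := ltgtP (w l 0) 0; last by rewrite (negPf wl).
  by rewrite ltr0_norm// ltr0_sg// => d1 d2; rewrite ler0_norm ?mulN1r//; lra.
by rewrite gtr0_norm// gtr0_sg// => d1 d2; rewrite ger0_norm ?mul1r//; lra.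
Qed.

(** * The least-norm subgradient *)

Lemma exists_min_dotp_sign_selection (R : realType) m n (K : 'M[R]_(m, n)) w :
  exists2 z, sign_selection w z &
    forall y, sign_selection w y ->
      dotp (K^T *m z) (K^T *m z) <= dotp (K^T *m y) (K^T *m y).
Proof.
(* Compactness comes from rV_compact, a statement on row vectors; hence the
   transpositions. *)
pose F (y : 'rV[R]_m) : R := dotp (K^T *m y^T) (K^T *m y^T).
pose I l := `[-1, 1] `&` [set c : R | c * w l 0 = `|w l 0|].
pose S := [set y : 'rV[R]_m | forall l, I l (y 0 l)].
have SE y : S y <-> sign_selection w y^T.
  by split=> H l; have := H l; rewrite /I /= in_itv/= mxE -ler_norml.
have cS : compact S.
  apply: rV_compact => l; apply: compact_closedI; first exact: segment_compact.
  apply: (@preimage_closed _ _ (fun c : R => c * w l 0) [set x | x = `|w l 0|]).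
    by move=> x _; exact: mulrr_continuous.
  exact: closed_eq.
(* Any step, here the zero one, provides an element of S. *)
have S0 : S !=set0.
  have [z [_ [zw _ _]]] := l1_small_step w 0.
  by exists z^T; apply/SE; rewrite trmxK.
have cF : continuous F.
  have ct i : continuous (fun y : 'rV[R]_m => (K^T *m y^T) i 0).
    have -> : (fun y : 'rV[R]_m => (K^T *m y^T) i 0) =
              (fun y => \sum_j K^T i j * y 0 j).
      by apply: funext => y; rewrite mxE; apply: eq_bigr => j _; rewrite !mxE.
    apply: continuous_big => [|j _ y]; first exact: add_continuous.
    apply: (@continuousM _ _ (cst (K^T i j)) (fun y : 'rV[R]_m => y 0 j)).
      exact: cst_continuous.
    exact: coord_continuous.
  apply: continuous_big => [|i _]; first exact: add_continuous.
  by move=> y; apply: continuousM; exact: ct.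
have [z] := compact_EVT_min S0 cS (continuous_subspaceT cF).
rewrite inE => /SE zS zmin; exists z^T => // y yw.
have := zmin y^T; rewrite /F trmxK; apply; rewrite inE; apply/SE.
by rewrite trmxK.
Qed.

(** A quadratic function that starts at 0 and stays nonnegative on [0, 1] has a
nonnegative slope at 0. *)
Lemma quadratic_slope_ge0 (R : realType) (b c : R) : 0 <= c ->
  (forall a, 0 <= a <= 1 -> 0 <= a * b + a ^+ 2 * c) -> 0 <= b.
Proof.
move=> c0 H; rewrite leNgt; apply/negP => b0.
have cb : 0 < c - b by lra.
(* At this a in [0, 1], a b + a^2 c = a^2 b < 0. *)
set a := - b / (c - b).
have aE : a * (c - b) = - b by rewrite divfK ?gt_eqF.
have a0 : 0 < a by rewrite divr_gt0// oppr_gt0.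
have a1 : a <= 1 by rewrite ler_pdivrMr//; lra.
have := H a; rewrite (ltW a0) a1 => /(_ isT).
have -> : a * b + a ^+ 2 * c = a ^+ 2 * b.
  have ac : a * c = a * b - b.
    by move: aE; rewrite mulrBr => /eqP; rewrite subr_eq addrC => /eqP.
  by rewrite expr2 -mulrA ac mulrBr mulrA addrC subrK.
by rewrite pmulr_rge0 ?exprn_gt0// leNgt b0.
Qed.

(** The variational inequality of the minimiser z, that is, of the projection of
0 onto the convex set of the vectors K^T y: moving from z towards y does not
decrease the norm. *)
Lemma sign_selection_projection (R : realType) m n (K : 'M[R]_(m, n)) w :
  exists2 z, sign_selection w z &
    forall y, sign_selection w y ->
      dotp (K^T *m z) (K^T *m z) <= dotp (K^T *m z) (K^T *m y).
Proof.
have [z zw zmin] := exists_min_dotp_sign_selection K w.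
exists z => // y yw; rewrite -subr_ge0 -dotpBr -mulmxBr.
set d := K^T *m (y - z).
suff: 0 <= 2 * dotp (K^T *m z) d by lra.
apply: (@quadratic_slope_ge0 R _ (dotp d d)) => [|a a01]; first exact: dotp_ge0.
have := zmin _ (sign_selection_segment a01 zw yw).
by rewrite mulmxDr -scalemxAr -/d dotp_sqrDZ; lra.
Qed.

(** Take for z the minimiser of |K^T z|. Both |q|^2 and |K^T z|^2 are at most
<q, K^T z>: the former because K^T z is itself a subgradient at u, the latter by
comparing J at u and after a small step along - K^T z. *)
Lemma min_subgradient_sign_selection (R : realType) m n (K : 'M[R]_(m, n)) u q :
  subdiff (l1_functional K) u q ->
  (forall p, subdiff (l1_functional K) u p -> dotp q q <= dotp q p) ->
  exists z, [/\ sign_selection (K *m u) z, q = K^T *m z &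
    forall y, sign_selection (K *m u) y -> dotp q q <= dotp q (K^T *m y)].
Proof.
move=> qu qmin.
have [z zu zmin] := sign_selection_projection K (K *m u).
exists z; have zq := qmin _ (subdiff_sign_selection zu).
suff qE : K^T *m z = q by split=> // y yu; rewrite -qE; exact: zmin.
apply: dotp_sqr_le_eq => //.
(* A small step along - K^T z decreases J by e <K^T y, K^T z>, which is at
   least e |K^T z|^2, whereas the subgradient q allows a decrease of at most
   e <q, K^T z>. *)
have [y [e [yu e0 yd]]] := l1_small_step (K *m u) (K *m (K^T *m z)).
have := qu (u - e *: (K^T *m z)).
rewrite /l1_functional mulmxBr -scalemxAr -(sign_selection_l1 yd).
rewrite -(sign_selection_l1 yu) (dotpBr y) dotpZr.
rewrite [_ - _ - u]addrAC subrr add0r -scaleNr dotpZr -!(dotp_trmx_mul K).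
have := zmin _ yu; rewrite (dotpC (K^T *m z)) => zy H.
rewrite -(ler_pM2l e0).
have : e * dotp (K^T *m z) (K^T *m z) <= e * dotp (K^T *m y) (K^T *m z).
  by rewrite ler_pM2l.
move: H; lra.
Qed.

(** The inequalities J(u - h q) + h <q, q> <= J(u), for q at u - h q, and
J(u) - h <q, p> <= J(u - h q), for p at u, combine to h <q, q> <= h <q, p>. *)
Lemma subdiff_min_norm_flow (R : realType) n (J : 'cV[R]_n -> R) u q h p :
  0 < h -> subdiff J (u - h *: q) q -> subdiff J u p ->
  dotp q q <= dotp q p.
Proof.
move=> h0 qu /(_ (u - h *: q)); have := qu u.
rewrite subKr [_ - _ - u]addrAC subrr add0r -scaleNr !dotpZr (dotpC p).
move=> H1 H2.
by rewrite -(ler_pM2l h0); lra.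
Qed.

(** * Diagonal dominance *)

(** The optimal sign vector z of w is also a sign vector of K K^T z: where
|z_l| = 1 by diagonal dominance, and where |z_l| < 1 because z_l can be moved in
both directions, so that the derivative (K K^T z)_l of |K^T z|^2 / 2 with
respect to z_l vanishes. *)
Lemma diag_dominant_sign_selection (R : realType) m n (K : 'M[R]_(m, n)) w z :
  diag_dominant (K *m K^T) -> sign_selection w z ->
  (forall y, sign_selection w y ->
     dotp (K^T *m z) (K^T *m z) <= dotp (K^T *m z) (K^T *m y)) ->
  sign_selection (K *m (K^T *m z)) z.
Proof.
move=> dd zw zmin l; have [zl1 zlw] := zw l; split=> //.
(* If |z_l| = 1, the off-diagonal part r of (K K^T z)_l is at most the diagonal
   entry in absolute value, so z_l (K K^T z)_l is nonnegative. *)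
have [zl|zl] := eqVneq `|z l 0| 1.
  rewrite -[RHS]mul1r -zl -normrM ger0_norm// mulmxA mxE (bigD1 l)//=.
  set A := K *m K^T; set r := \sum_(j | _) _.
  have All : 0 <= A l l.
    by rewrite mxE sumr_ge0// => j _; rewrite mxE -expr2 sqr_ge0.
  have rA : `|r| <= A l l.
    rewrite -[leRHS]ger0_norm//; apply: le_trans (ler_norm_sum _ _ _) _.
    apply: le_trans (dd l); apply: ler_sum => j _; rewrite normrM ler_piMr//.
    by have [] := zw j.
  move: rA zl; rewrite ler_norml => /andP[r1 r2] /eqP.
  by rewrite eqr_norml => /andP[/orP[]/eqP-> _]; lra.
have {zl1}zl : -1 < z l 0 < 1 by rewrite -ltr_norml lt_neqAle zl.
have wl : w l 0 = 0.
  apply/eqP; apply: contraT => wl; have := zl; rewrite -ltr_norml.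
  rewrite -(ltr_pM2r (_ : 0 < `|w l 0|)) ?normr_gt0//.
  by rewrite -normrM zlw normr_id mul1r ltxx.
(* Only the entry l of z is changed, to an arbitrary c in [-1, 1]. *)
have slope c : `|c| <= 1 -> 0 <= (c - z l 0) * (K *m (K^T *m z)) l 0.
  move=> c1; pose y := z + (c - z l 0) *: delta_mx l 0.
  have yw : sign_selection w y.
    move=> k; rewrite !mxE andbT; case: eqP => [->|_]; last first.
      by rewrite mulr0 addr0.
    by rewrite mulr1 addrC subrK wl mulr0 normr0.
  have := zmin _ yw; rewrite mulmxDr dotpDr lerDl -scalemxAr dotpZr.
  rewrite [dotp _ (K^T *m _)]dotpC dotp_trmx_mul.
  rewrite [dotp (delta_mx _ _) _](bigD1 l)//=.
  rewrite big1 ?addr0 ?mxE ?eqxx ?mul1r// => k kl.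
  by rewrite mxE (negPf kl) mul0r.
have := slope 1; have := slope (-1); rewrite normrN normr1 lexx.
move: ((K *m _) l 0) => d /(_ isT) d1 /(_ isT) d2.
suff -> : d = 0 by rewrite mulr0 normr0.
have /andP[z1 z2] := zl.
apply/eqP; rewrite eq_le; apply/andP; split.
  by rewrite -(nmulr_rge0 _ (_ : -1 - z l 0 < 0))//; lra.
by rewrite -(pmulr_rge0 _ (_ : 0 < 1 - z l 0))//; lra.
Qed.

Lemma diag_dominant_min_subgradient (R : realType) m n (K : 'M[R]_(m, n))
    u q h :
  diag_dominant (K *m K^T) -> 0 < h ->
  subdiff (l1_functional K) u q -> subdiff (l1_functional K) (u - h *: q) q ->
  subdiff (l1_functional K) q q.
Proof.
move=> dd h0 qu qu'.
have qmin p : subdiff (l1_functional K) u p -> dotp q q <= dotp q p.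
  exact: subdiff_min_norm_flow h0 qu'.
have [z [zu qE zmin]] := min_subgradient_sign_selection qu qmin.
rewrite {2}qE; apply: subdiff_sign_selection; rewrite qE.
apply: diag_dominant_sign_selection dd zu _ => y yu.
by rewrite -qE; exact: zmin.
Qed.

(** * Eigenvectors and the null space *)

(** J is constant in the direction v, so both v and - v give a nonpositive
product with p. *)
Lemma subdiff_dotp_null (R : realType) m n (K : 'M[R]_(m, n)) u p v :
  subdiff (l1_functional K) u p -> K *m v = 0 -> dotp p v = 0.
Proof.
move=> pu Kv.
have shift a : a * dotp p v <= 0.
  have := pu (u + a *: v).
  rewrite /l1_functional mulmxDr -scalemxAr Kv scaler0 addr0.
  by rewrite addrAC subrr add0r dotpZr gerDl.
by have := shift 1; have := shift (-1); lra.
Qed.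

Lemma l2normZ (R : realType) n (a : R) (u : 'cV[R]_n) :
  l2norm (a *: u) = `|a| * l2norm u.
Proof.
rewrite /l2norm dotpZr dotpC dotpZr mulrA -expr2 sqrtrM ?sqr_ge0//.
by rewrite sqrtr_sqr.
Qed.

(** Subgradients of J do not change under positive scaling of the base point, so
normalising u only multiplies the eigenvalue by the norm of u. *)
Lemma eigenvector_l1_normalized (R : realType) m n (K : 'M[R]_(m, n)) a u :
  u != 0 -> subdiff (l1_functional K) u (a *: u) ->
  eigenvector_upto_norm (l1_functional K) u.
Proof.
move=> u0 au; split=> //.
have nu : 0 < l2norm u by rewrite sqrtr_gt0 dotp_gt0.
split; first by rewrite l2normZ gtr0_norm ?invr_gt0// mulVf ?gt_eqF.
exists (a * l2norm u); rewrite scalerA -mulrA divff ?gt_eqF// mulr1.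
by apply: subdiff_Z; rewrite ?invr_gt0.
Qed.

(** * Gradient flows *)

Lemma ae_exists_itv (R : realType) (P : R -> Prop) (a b : R) : a < b ->
  {ae @lebesgue_measure R, forall t : R, P t} ->
  exists2 s, a < s < b & P s.
Proof.
move=> ab [A [mA A0 PA]]; apply: contrapT => nP.
have : `]a, b[ `<=` A.
  by move=> s /=; rewrite in_itv/= => sab; apply: PA => Ps; apply: nP; exists s.
have mab : measurable (`]a, b[ : set R) by exact: measurable_itv.
move=> abA.
have : (@lebesgue_measure R `]a, b[ <= @lebesgue_measure R A)%E.
  by apply: le_measure; rewrite ?inE.
rewrite A0 lebesgue_measure_itv/= lte_fin ab -EFinB lee_fin leNgt => /negP[].
by rewrite subr_gt0.
Qed.

Lemma breakpoints_le (R : realType) n u p N t (q : nat -> 'cV[R]_n) i j :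
  flow_breakpoints u p N t q -> (i <= j <= N)%N -> t i <= t j.
Proof.
move=> bp /andP[]; elim: j => [|j IHj]; first by rewrite leqn0 => /eqP->.
rewrite leq_eqVlt => /predU1P[->//|ij] jN.
by apply: le_trans (IHj ij (ltnW jN)) _; exact/ltW/(bp_increasing bp).
Qed.

Lemma breakpoints_ge0 (R : realType) n u p N t (q : nat -> 'cV[R]_n) i :
  flow_breakpoints u p N t q -> (i <= N)%N -> 0 <= t i.
Proof. by move=> bp iN; rewrite -(bp_start bp) (breakpoints_le bp). Qed.

(** The flow equation and the constancy of p hold only almost everywhere, so the
subgradient property of q is obtained at some time of any given subinterval. *)
Lemma exists_flow_subgradient (R : realType) n (J : 'cV[R]_n -> R) f u p N t q
    i a b :
  gradient_flow J f u p -> flow_breakpoints u p N t q -> (i < N)%N ->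
  t i <= a -> a < b -> b <= t i.+1 ->
  exists2 s, a < s < b & subdiff J (u s) (q i.+1).
Proof.
move=> flow bp iN ta ab bt.
have H : {ae @lebesgue_measure R, forall s : R,
    (0 < s -> is_derive s 1 u (- p s) /\ subdiff J (u s) (p s)) /\
    (t i < s < t i.+1 -> p s = q i.+1)}.
  apply: (@filterI _ _ (ae_filter_ringOfSetsType (@lebesgue_measure R))).
    exact: gf_flow flow.
  exact: bp_constant bp _ iN.
have [s /andP[sa sb] [su sq]] := ae_exists_itv ab H.
exists s; first by rewrite sa sb.
rewrite -sq ?(le_lt_trans ta sa) ?(lt_le_trans sb bt)//.
apply: (su _).2; apply: le_lt_trans sa; apply: le_trans ta.
exact: breakpoints_ge0 bp (ltnW iN).
Qed.

Lemma flow_decomposition (R : realType) n (J : 'cV[R]_n -> R) f u p N t q k :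
  gradient_flow J f u p -> flow_breakpoints u p N t q -> (k <= N)%N ->
  f = u (t k) + \sum_(i < k) (t i.+1 - t i) *: q i.+1.
Proof.
move=> flow bp; elim: k => [_|k IHk kN].
  by rewrite big_ord0 addr0 (bp_start bp) (gf_init flow).
rewrite {1}IHk 1?ltnW// big_ord_recr/= (bp_affine bp kN (s := t k.+1)).
  by rewrite [RHS]addrACA addNr addr0.
by rewrite lexx andbT ltW ?(bp_increasing bp).
Qed.

(** The q j.+1 are subgradients, hence orthogonal to the null space of K, so
the flow does not change the component of f in that space. *)
Lemma flow_dotp_null (R : realType) m n (K : 'M[R]_(m, n)) f u p N t q v i s :
  gradient_flow (l1_functional K) f u p -> flow_breakpoints u p N t q ->
  K *m v = 0 -> (i < N)%N -> t i <= s <= t i.+1 -> dotp v (u s) = dotp v f.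
Proof.
move=> flow bp Kv iN tst.
have vq j : (j < N)%N -> dotp v (q j.+1) = 0.
  move=> jN.
  have [r _ rq] := exists_flow_subgradient flow bp jN (lexx _)
    (bp_increasing bp jN) (lexx _).
  by rewrite dotpC; exact: subdiff_dotp_null rq Kv.
have vt : forall k, (k <= N)%N -> dotp v (u (t k)) = dotp v f.
  elim=> [_|k IHk kN]; first by rewrite (bp_start bp) (gf_init flow).
  rewrite (bp_affine bp kN) ?lexx ?ltW ?(bp_increasing bp)//.
  by rewrite dotpBr dotpZr vq// mulr0 subr0 IHk// ltnW.
by rewrite (bp_affine bp iN tst) dotpBr dotpZr vq// mulr0 subr0 vt// ltnW.
Qed.

Lemma null_dotp_P0 (R : realType) m n (K : 'M[R]_(m, n)) f w :
  K *m w = 0 -> (forall v, K *m v = 0 -> dotp v w = dotp v f) ->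
  w = P0 (l1_functional K) f.
Proof.
move=> Kw wf; have [/null_set_l1 KP Pf] := orth_proj_null_l1 K f.
apply/eqP; rewrite -subr_eq0; apply/eqP/dotp_eq0.
have Kv : K *m (w - P0 (l1_functional K) f) = 0 by rewrite mulmxBr Kw KP subrr.
rewrite dotpBr wf// -dotpBr dotpC.
exact/Pf/null_set_l1.
Qed.

Theorem theorem9 (R : realType) (m n : nat) (K : 'M[R]_(m, n)) (f : 'cV[R]_n)
    (uGF pGF : R -> 'cV[R]_n) (N : nat) (t : nat -> R) (q : nat -> 'cV[R]_n) :
  let J := l1_functional K in
  diag_dominant (K *m K^T) ->
  gradient_flow J f uGF pGF ->
  flow_breakpoints uGF pGF N t q ->
  extinction_time J f uGF (t N) ->
  (forall i : nat, (i < N)%N ->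
     subdiff J (q i.+1) (q i.+1) /\ eigenvector_upto_norm J (q i.+1)) /\
  f = P0 J f + \sum_(i < N) (t i.+1 - t i) *: q i.+1 /\
  (P0 J f != 0 -> eigenvector_upto_norm J (P0 J f)).
Proof.
move=> J dd flow bp [uT ext]; split=> [i iN|]; last split=> [|P0f].
(* Times s < r in the two halves of the interval provide the two points at
   which q i.+1 is a subgradient. *)
- have tt := bp_increasing bp iN; set c := (t i + t i.+1) / 2.
  have [tc ct] : t i < c /\ c < t i.+1 by rewrite /c; lra.
  have [s /andP[ts sc] su] :=
    exists_flow_subgradient flow bp iN (lexx _) tc (ltW ct).
  have [r /andP[cr rt] ru] :=
    exists_flow_subgradient flow bp iN (ltW tc) ct (lexx _).
  have sI : t i <= s <= t i.+1 by lra.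
  have qq : subdiff J (q i.+1) (q i.+1).
    apply: (diag_dominant_min_subgradient (h := r - s) dd _ su); first by lra.
    have rI : t i <= r <= t i.+1 by lra.
    rewrite (_ : _ - _ = uGF r)//.
    rewrite (bp_affine bp iN sI) (bp_affine bp iN rI) -addrA -opprD -scalerDl.
    by congr (_ - _ *: _); ring.
  split=> //; apply: (@eigenvector_l1_normalized _ _ _ _ 1); last first.
    by rewrite scale1r.
  (* If q i.+1 = 0, then J (uGF s) <= J 0 = 0, so that uGF s is the projection
     of f before the extinction time. *)
  apply/eqP => q0; apply: (ext s).
    rewrite (le_trans (breakpoints_ge0 bp (ltnW iN)) (ltW ts))/=.
    by rewrite (lt_le_trans (lt_trans sc ct))// (breakpoints_le bp)// iN leqnn.
  apply: null_dotp_P0 => [|v Kv]; last exact: flow_dotp_null flow bp Kv iN sI.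
  apply/null_set_l1/eqP; rewrite eq_le sumr_ge0 ?andbT//.
  have := su 0; rewrite q0 /dotp big1 ?addr0.
    by rewrite /J/l1_functional mulmx0 -(scale0r 0) l1normZ normr0 mul0r.
  by move=> k _; rewrite mxE mul0r.
- by rewrite -uT; exact: flow_decomposition flow bp (leqnn N).
(* J vanishes at the projection, which is thus a minimiser: eigenvalue 0. *)
- apply: (@eigenvector_l1_normalized _ _ _ _ 0) => //.
  have [P0 _] := orth_proj_null_l1 K f.
  move=> v; rewrite scale0r P0 /dotp big1 ?addr0; first exact: sumr_ge0.
  by move=> k _; rewrite mxE mul0r.
Qed.
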